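(* Let $F_A$ be the free group with finite basis $A$. The membership problem for $F_A$ is solvable: there exists an algorithm which, given a finite family of words $u,v_1,\ldots,v_k$ in $A^{\pm}=A\sqcup A^{-1}$, decides whether the element of $F_A$ represented by $u$ belongs to the subgroup $\langle v_1,\ldots,v_k\rangle\leqslant F_A$ and, if so, outputs an expression of $u$ as a product of the elements $v_1^{\pm1},\ldots,v_k^{\pm1}$.
   Context: $A^{-1}$ denotes the set of formal inverses of the letters in $A$. Words in $A^{\pm}$ represent elements of $F_A$ in the usual way. *)

(* Defs.v *)
From HB Require Import structures.
From mathcomp Require Import all_boot.
Set Implicit Arguments.
Unset Strict Implicit.
Unset Printing Implicit Defensive.

(* Words in the letters of [T] and their formal inverses: [(a, false)] is the *)
(* letter [a], and [(a, true)] its inverse.                                   *)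
Definition word (T : Type) : Type := seq (T * bool).

Definition word_prod (T : Type) (G : groupType) (g : T -> G) (w : word T) : G :=
  (\prod_(x <- w) (if x.2 then (g x.1)^-1 else g x.1))%g.

Section FreeGroup.

Variable A : finType.
Implicit Types (l : A * bool) (w s : word A).

Definition linv l : A * bool := (l.1, ~~ l.2).

Definition reduced w : bool := sorted (fun l1 l2 => l2 != linv l1) w.

Definition lcons l w : word A :=
  if w is l1 :: w1 then if l1 == linv l then w1 else l :: w else [:: l].

Definition reduce w : word A := foldr lcons [::] w.

Lemma linvK : involutive linv.
Proof. by case=> a b; rewrite /linv /= negbK. Qed.

Lemma reduced_behead l w : reduced (l :: w) -> reduced w.
Proof. by case: w => //= l1 w /andP[]. Qed.

Lemma lcons_reduced l w : reduced w -> reduced (lcons l w).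
Proof.
case: w => //= l1 w r; case: eqP => [_|/eqP n1]; first exact: reduced_behead r.
by rewrite /reduced /= n1.
Qed.

Lemma act_reduced w s : reduced s -> reduced (foldr lcons s w).
Proof. by move=> rs; elim: w => //= l w; exact: lcons_reduced. Qed.

Lemma reduce_reduced w : reduced (reduce w).
Proof. exact: act_reduced. Qed.

Lemma lconsK l s : reduced s -> lcons l (lcons (linv l) s) = s.
Proof.
case: s => [|l1 s] /=; first by rewrite eqxx.
rewrite linvK; case: eqP => [->|_] r; last by rewrite /= eqxx.
by case: s r => //= l2 s /andP[/negPf ->].
Qed.

Lemma act_lcons l w s :
  reduced s -> foldr lcons s (lcons l w) = lcons l (foldr lcons s w).
Proof.
move=> rs; case: w => //= l1 w; case: eqP => [->|//].
by rewrite lconsK //; exact: act_reduced.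
Qed.

Lemma act_reduce w s :
  reduced s -> foldr lcons s (reduce w) = foldr lcons s w.
Proof. by move=> rs; elim: w => //= l w <-; rewrite act_lcons. Qed.

Lemma reduce_id w : reduced w -> reduce w = w.
Proof.
elim: w => //= l w IHw r; rewrite IHw ?(reduced_behead r) //.
by case: w r {IHw} => //= l1 w /andP[/negPf ->].
Qed.

(* [F_A]: freely reduced words, multiplied by concatenation and reduction. *)
Record freeGroup : Type :=
  FreeGroup { free_word : word A; free_wordP : reduced free_word }.

HB.instance Definition _ := [isSub for free_word].
HB.instance Definition _ := [Choice of freeGroup by <:].

Implicit Types x y z : freeGroup.

Definition free_of_word w : freeGroup := FreeGroup (reduce_reduced w).
Definition free_one : freeGroup := free_of_word [::].
Definition free_mul x y : freeGroup := free_of_word (val x ++ val y).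
Definition free_inv x : freeGroup := free_of_word (rev (map linv (val x))).

Lemma val_free_mul x y : val (free_mul x y) = foldr lcons (val y) (val x).
Proof. by rewrite /= /reduce foldr_cat -/(reduce _) reduce_id //; exact: (valP y). Qed.

Lemma free_mulA : associative free_mul.
Proof.
move=> x y z; apply: val_inj; rewrite !val_free_mul.
rewrite -(val_free_mul x y) act_reduce ?foldr_cat //; exact: (valP z).
Qed.

Lemma free_mul1g : left_id free_one free_mul.
Proof. by move=> x; apply: val_inj; rewrite val_free_mul. Qed.

Lemma free_mulg1 : right_id free_one free_mul.
Proof. by move=> x; apply: val_inj; rewrite val_free_mul -/(reduce _) reduce_id ?(valP x). Qed.

Lemma act_rev_linv w s :
  reduced s -> foldr lcons (foldr lcons s w) (rev (map linv w)) = s.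
Proof.
move=> rs; elim: w => //= l w IHw.
rewrite rev_cons -cats1 foldr_cat /= -[X in lcons _ (lcons X _)]linvK.
by rewrite lconsK //; exact: act_reduced.
Qed.

Lemma free_mulVg : left_inverse free_one free_inv free_mul.
Proof.
move=> x; apply: val_inj; rewrite val_free_mul act_reduce; last exact: (valP x).
by rewrite -{1}[val x]reduce_id ?act_rev_linv ?(valP x).
Qed.

Lemma free_mulgV : right_inverse free_one free_inv free_mul.
Proof.
move=> x; rewrite -[LHS]free_mul1g -{1}(free_mulVg (free_inv x)) -free_mulA.
by rewrite [X in free_mul _ X]free_mulA free_mulVg free_mul1g free_mulVg.
Qed.

HB.instance Definition _ := isGroup.Build freeGroup
  free_mulA free_mul1g free_mulg1 free_mulVg free_mulgV.

Definition free_gen (a : A) : freeGroup := free_of_word [:: (a, false)].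

Lemma free_prod_gen x : word_prod free_gen (val x) = x.
Proof.
suff H w : word_prod free_gen w = free_of_word w.
  by rewrite H; apply: val_inj; rewrite /= reduce_id ?(valP x).
elim: w => [|[a b] w IHw]; first by rewrite /word_prod big_nil.
rewrite /word_prod big_cons -/(word_prod _ _) IHw /=.
by apply: val_inj; case: b; rewrite /= -/(reduce _) (reduce_id (reduce_reduced w)).
Qed.

Lemma word_prod_lcons (G : groupType) (g : A -> G) l w :
  word_prod g (lcons l w) = word_prod g (l :: w).
Proof.
case: w => //= -[a1 b1] w; case: eqP => // -[-> ->].
by rewrite /word_prod !big_cons /=; case: l.2; rewrite /= ?mulKg ?mulVKg.
Qed.

Lemma free_gen_universal (G : groupType) (g : A -> G) :
  exists h : freeGroup -> G,
    [/\ {morph h : x y / (x * y)%g >-> (x * y)%g},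
        forall a, h (free_gen a) = g a &
        forall h' : freeGroup -> G,
          {morph h' : x y / (x * y)%g >-> (x * y)%g} ->
          (forall a, h' (free_gen a) = g a) -> h' =1 h].
Proof.
exists (fun x => word_prod g (val x)); split=> [x y|a|h' hM hg x].
- rewrite [val _]val_free_mul /word_prod -big_cat /= -!/(word_prod g _).
  elim: (val x) => //= l w; rewrite word_prod_lcons /word_prod !big_cons.
  by move->.
- by rewrite /word_prod big_seq1.
have h1 : h' 1%g = 1%g.
  by apply: (mulgI (h' 1%g)); rewrite -hM !mulg1.
have hV y : h' (y^-1)%g = (h' y)^-1%g.
  by apply: (mulgI (h' y)); rewrite -hM !mulgV.
rewrite -{1}[x]free_prod_gen; elim: (val x) => [|[a b] w IHw].
  by rewrite /word_prod !big_nil.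
rewrite /word_prod !big_cons hM; congr (_ * _)%g; last exact: IHw.
by case: b => /=; rewrite ?hV hg.
Qed.

Definition word_elt (w : word A) : freeGroup := word_prod free_gen w.

End FreeGroup.

Definition is_subgroup (G : groupType) (H : G -> Prop) : Prop :=
  [/\ H 1%g, forall x y, H x -> H y -> H (x * y)%g
    & forall x, H x -> H (x^-1)%g].

Definition subgroup_gen (T : Type) (G : groupType) (g : T -> G) (x : G) : Prop :=
  forall H : G -> Prop, is_subgroup H -> (forall i, H (g i)) -> H x.

(* Algorithms are partial recursive functions; [recfun n] is the type of      *)
(* their definitions in [n] variables.                                        *)
Inductive recfun : nat -> Type :=
| Zero n : recfun n
| Succ : recfun 1
| Proj n (i : 'I_n) : recfun n
| Comp m n (f : recfun m) (g : 'I_m -> recfun n) : recfun n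
| Prec n (f : recfun n) (g : recfun n.+2) : recfun n.+1
| Mu n (f : recfun n.+1) : recfun n.

(* [computes p x y]: [p] halts on [x] with value [y]. In the case of          *)
(* primitive recursion on the first argument, [s] lists the successive values.*)
Fixpoint computes n (p : recfun n) : n.-tuple nat -> nat -> Prop :=
  match p in recfun n return n.-tuple nat -> nat -> Prop with
  | Zero _ => fun _ y => y = 0
  | Succ => fun x y => y = (thead x).+1
  | Proj _ i => fun x y => y = tnth x i
  | Comp m _ f g => fun x y =>
      exists2 z : m.-tuple nat,
        forall i, computes (g i) x (tnth z i) & computes f z y
  | Prec _ f g => fun x y =>
      exists s : nat -> nat,
        [/\ computes f [tuple of behead x] (s 0),
            forall i, i < thead x ->
              computes g [tuple of [:: i, s i & behead x]] (s i.+1)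
          & y = s (thead x)]
  | Mu _ f => fun x y =>
      computes f [tuple of y :: x] 0 /\
      forall i, i < y -> exists z, computes f [tuple of i :: x] z.+1
  end.

Lemma computes_functional n (p : recfun n) x y1 y2 :
  computes p x y1 -> computes p x y2 -> y1 = y2.
Proof.
elim: p x y1 y2 => {n} /= [n x y1 y2 -> ->|x y1 y2 -> ->|n i x y1 y2 -> ->
  |m n f IHf g IHg x y1 y2 [z1 gz1 fz1] [z2 gz2 fz2]
  |n f IHf g IHg x y1 y2 [s1 [f1 g1 ->]] [s2 [f2 g2 ->]]
  |n f IHf x y1 y2 [f1 lt1] [f2 lt2]] //.
- suff z12 : z1 = z2 by apply: IHf fz1 _; rewrite z12.
  by apply: eq_from_tnth => i; apply: IHg (gz1 i) (gz2 i).
- elim: {-2}(thead x) (leqnn (thead x)) => [|i IHi] lei; first exact: IHf f1 f2.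
  have e := IHi (ltnW lei).
  by apply: IHg (g1 i lei) _; rewrite e; exact: g2.
- case: (ltngtP y1 y2) => // lt12.
    by have [z /(IHf _ _ _ f1)] := lt2 _ lt12.
  by have [z /(IHf _ _ _ f2)] := lt1 _ lt12.
Qed.

(* Goedel numbering of inputs and outputs: the letter [x^±1] gets the number  *)
(* [2 n] or [2 n + 1], where [n] numbers [x] ([enum_rank] for [x] in [A], the *)
(* index [i] for the generator [v_i]).                                        *)
Definition code_word_by (T : Type) (num : T -> nat) (w : word T) : nat :=
  CodeSeq.code [seq (num x.1).*2 + (x.2 : bool) | x <- w].

Definition code_word (A : finType) (w : word A) : nat :=
  code_word_by (fun a => enum_rank a : nat) w.

Definition code_words (A : finType) (v : seq (word A)) : nat :=
  CodeSeq.code [seq code_word w | w <- v].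

(* [None] is the answer "no", [Some e] the answer "yes" with expression [e]. *)
Definition code_answer k (o : option (word 'I_k)) : nat :=
  if o is Some e then (code_word_by (@nat_of_ord k) e).+1 else 0.

Definition correct_answer (A : finType) (u : word A) k (v : k.-tuple (word A))
    (o : option (word 'I_k)) : Prop :=
  let g i := word_elt (tnth v i) in
  if o is Some e
  then subgroup_gen g (word_elt u) /\ word_elt u = word_prod g e
  else ~ subgroup_gen g (word_elt u).

(* Main.v *)
(* The algorithm is an unbounded search for a certificate. If [u] lies in the *)
(* subgroup [H] generated by the [v_i], a certificate is an expression of [u],*)
(* checked by free reduction. If not, let [F_A] act on the cosets of [H]:     *)
(* each letter maps the finitely many cosets of prefixes of [u] and of the    *)
(* [v_i] injectively, as far as it keeps them among themselves, and these     *)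
(* partial injections extend to permutations (M. Hall). The resulting finite  *)
(* permutation action, in which all the [v_i] fix the base point and [u] does *)
(* not, certifies that [u] is not in [H].                                     *)

Require Import Defs.
From mathcomp Require Import all_boot.
From Stdlib Require Import ClassicalEpsilon.
Set Implicit Arguments.
Unset Strict Implicit.
Unset Printing Implicit Defensive.

(** * Recursive functions *)

(** Both answers have finite certificates that a recursive function can check, so trying all numbers
    in turn decides membership. Two things have to be shown.

    The check is right. By [mem_checkP], a positive certificate is exactly an expression of [u] in
    the generators: elements of the free group are equal iff their reduced words are. By
    [nonmem_check_sound], a negative one is a permutation action in which the stabilizer of 0
    contains every [v_i], hence all of the subgroup, but not [u].

    A certificate always exists. For members this is [subgroup_gen_prod]. For the others it is
    [nonmem_check_complete], which rests on [coset_action] and [partial_injection_swaps]: only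
    finitely many cosets are met in tracing [u] and the [v_i] from the base coset, and the partial
    injections on them extend to permutations. This existence proof is classical; the algorithm
    itself, from [candidate_search], is a single minimization that halts because a certificate
    exists. The [rec_*] lemmas show that the check is recursive. *)

Definition recursive n (f : seq nat -> nat) : Prop :=
  exists p : recfun n, forall x : n.-tuple nat, computes p x (f x).

Lemma recursive_ext n (f g : seq nat -> nat) :
  recursive n f -> (forall x : n.-tuple nat, f x = g x) -> recursive n g.
Proof. by case=> p pf fg; exists p => x; rewrite -fg. Qed.

(** Variables are entries of a plain list, so that bodies of functions need no dependent types; on
    lists of length [n] the default 0 is never read. *)
Lemma rec_var n i : i < n -> recursive n (fun x => nth 0 x i).
Proof.
by move=> ltin; exists (Proj (Ordinal ltin)) => x /=; rewrite (tnth_nth 0).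
Qed.

Lemma rec_comp n f (gs : seq (seq nat -> nat)) :
  recursive (size gs) f ->
  (forall i, i < size gs -> recursive n (nth (fun=> 0) gs i)) ->
  recursive n (fun x => f [seq g x | g <- gs]).
Proof.
case=> p pf rg.
have [q qg] := fin_all_exists (fun i : 'I_(size gs) => rg i (ltn_ord i)).
exists (Comp p q) => x /=.
exists (map_tuple (fun g : seq nat -> nat => g x) (in_tuple gs)); last exact: pf.
by move=> i; rewrite tnth_map (tnth_nth (fun=> 0)).
Qed.

Definition rec1 (F : nat -> nat) := recursive 1 (fun x => F (nth 0 x 0)).
Definition rec2 (F : nat -> nat -> nat) :=
  recursive 2 (fun x => F (nth 0 x 0) (nth 0 x 1)).
Definition rec3 (F : nat -> nat -> nat -> nat) :=
  recursive 3 (fun x => F (nth 0 x 0) (nth 0 x 1) (nth 0 x 2)).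

Lemma rec_app1 F n f :
  rec1 F -> recursive n f -> recursive n (fun x => F (f x)).
Proof. by move=> rF rf; apply: (rec_comp (gs := [:: f]) rF); case. Qed.

Lemma rec_app2 F n f g :
  rec2 F -> recursive n f -> recursive n g ->
  recursive n (fun x => F (f x) (g x)).
Proof.
by move=> rF rf rg; apply: (rec_comp (gs := [:: f; g]) rF); case=> [|[]].
Qed.

Lemma rec_app3 F n f g h :
  rec3 F -> recursive n f -> recursive n g -> recursive n h ->
  recursive n (fun x => F (f x) (g x) (h x)).
Proof.
move=> rF rf rg rh.
by apply: (rec_comp (gs := [:: f; g; h]) rF); case=> [|[|[]]].
Qed.

Lemma rec_nat n f g h :
  recursive n f -> recursive n.+2 g -> (forall x, h (0 :: x) = f x) ->
  (forall i x, h (i.+1 :: x) = g [:: i, h (i :: x) & x]) ->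
  recursive n.+1 h.
Proof.
move=> [p pf] [q qg] h0 hS; exists (Prec p q) => x /=.
exists (fun i => h (i :: behead x)); split=> [|i _|].
- by rewrite h0; apply: pf.
- by rewrite hS; apply: qg.
- by case/tupleP: x => a x; rewrite theadE.
Qed.

Lemma rec_mu n f (h : seq nat -> nat) :
  recursive n.+1 f ->
  (forall x, f (h x :: x) = 0 /\ forall i, i < h x -> f (i :: x) <> 0) ->
  recursive n h.
Proof.
move=> [p pf] hP; exists (Mu p) => x /=; have [h0 lth] := hP x.
split=> [|i /lth fi]; first by rewrite -h0; apply: pf.
by exists (f (i :: x)).-1; rewrite prednK ?lt0n; [apply: pf | apply/eqP].
Qed.

Lemma rec_succ n f : recursive n f -> recursive n (fun x => (f x).+1).
Proof.
by apply: rec_app1; exists Succ => x /=; case/tupleP: x => a x; rewrite theadE.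
Qed.

Lemma rec_const n c : recursive n (fun=> c).
Proof.
by elim: c => [|c]; [exists (Zero n) | apply: rec_succ].
Qed.

Lemma rec_iter1 F : rec1 F -> rec2 (fun i a => iter i F a).
Proof.
move=> rF; apply: (rec_nat (f := fun x => nth 0 x 0)
  (g := fun x => F (nth 0 x 1))) => //; first exact: rec_var.
by apply: rec_app1 => //; apply: rec_var.
Qed.

Lemma rec_iter F n f g : rec1 F -> recursive n f -> recursive n g ->
  recursive n (fun x => iter (f x) F (g x)).
Proof. by move=> /rec_iter1; exact: rec_app2. Qed.

Lemma rec_add n f g : recursive n f -> recursive n g ->
  recursive n (fun x => f x + g x).
Proof.
move=> rf rg; have rS : rec1 S by apply: rec_succ; apply: rec_var.
by apply: recursive_ext (rec_iter rS rf rg) _ => x; rewrite iter_succn addnC.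
Qed.

Lemma rec_pred n f : recursive n f -> recursive n (fun x => (f x).-1).
Proof.
apply: (rec_app1 (F := predn)).
apply: (rec_nat (f := fun=> 0) (g := fun x => nth 0 x 0)) => //.
  exact: rec_const.
exact: rec_var.
Qed.

Lemma rec_sub n f g : recursive n f -> recursive n g ->
  recursive n (fun x => f x - g x).
Proof.
move=> rf rg; have rP : rec1 predn by apply: rec_pred; apply: rec_var.
apply: recursive_ext (rec_iter rP rg rf) _ => x.
by elim: (g x) => [|i /= ->]; rewrite ?subn0 ?subnS.
Qed.

Lemma rec_if n (b : seq nat -> bool) f g :
  recursive n (fun x => b x) -> recursive n f -> recursive n g ->
  recursive n (fun x => if b x then f x else g x).
Proof.
(* Primitive recursion on [c] that ignores the previous value. *)
have rif : rec3 (fun c y z => if c is 0 then z else y).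
  apply: (rec_nat (f := fun x => nth 0 x 1) (g := fun x => nth 0 x 2)) => //;
  exact: rec_var.
move=> rb rf rg; apply: recursive_ext (rec_app3 rif rb rf rg) _ => x.
by case: (b x).
Qed.

Lemma rec_leq n f g : recursive n f -> recursive n g ->
  recursive n (fun x => f x <= g x).
Proof.
move=> rf rg.
have rz : rec1 (fun i => i == 0).
  apply: (rec_nat (f := fun=> 1) (g := fun=> 0)) => //; exact: rec_const.
exact: (rec_app1 rz (rec_sub rf rg)).
Qed.

Lemma rec_and n (b c : seq nat -> bool) :
  recursive n (fun x => b x) -> recursive n (fun x => c x) ->
  recursive n (fun x => b x && c x).
Proof.
move=> rb rc; apply: recursive_ext (rec_if rb rc (rec_const n 0)) _ => x.
by case: (b x).
Qed.

Lemma rec_eq n f g : recursive n f -> recursive n g ->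
  recursive n (fun x => f x == g x).
Proof.
move=> rf rg; apply: recursive_ext (rec_and (rec_leq rf rg) (rec_leq rg rf)) _.
by move=> x; rewrite eqn_leq.
Qed.

Lemma rec_negb n (b : seq nat -> bool) :
  recursive n (fun x => b x) -> recursive n (fun x => ~~ b x).
Proof.
move=> rb.
apply: recursive_ext (rec_if rb (rec_const n 0) (rec_const n 1)) _ => x.
by case: (b x).
Qed.

Lemma rec_odd n f : recursive n f -> recursive n (fun x => odd (f x)).
Proof.
apply: (rec_app1 (F := fun i => odd i)).
apply: (rec_nat (f := fun=> 0) (g := fun x => 1 - nth 0 x 1)) => //.
- exact: rec_const.
- by apply: rec_sub; [apply: rec_const | apply: rec_var].
- by move=> i x /=; case: (odd i).
Qed.

Lemma rec_half n f : recursive n f -> recursive n (fun x => (f x)./2).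
Proof.
apply: (rec_app1 (F := half)).
apply: (rec_nat (f := fun=> 0) (g := fun x => odd (nth 0 x 0) + nth 0 x 1)) => //.
- exact: rec_const.
- by apply: rec_add; [apply: rec_odd |]; apply: rec_var.
- by move=> i x /=; rewrite uphalf_half.
Qed.

(** * Lists as numbers *)

Notation code := CodeSeq.code.
Notation decode := CodeSeq.decode.

Lemma code_inj : injective code.
Proof. exact: can_inj CodeSeq.codeK. Qed.

(** List operations transported along the bijection [code] between lists and numbers, where [code
    [::] = 0] and [code (n :: s) = 2 ^ n * (2 * code s + 1)]. The head is thus the 2-adic
    valuation. *)
Definition cons_code n m := code (n :: decode m).
Definition head_code m := head 0 (decode m).
Definition behead_code m := code (behead (decode m)).
Definition nth_code m i := nth 0 (decode m) i.
Definition size_code m := size (decode m).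

Lemma cons_codeE n m : cons_code n m = iter n double m.*2.+1.
Proof.
rewrite /cons_code /= CodeSeq.decodeK; elim: n => [|n /= <-]; rewrite ?mul1n //.
by rewrite expnS -mulnA mul2n.
Qed.

Lemma code_cons n s : code (n :: s) = iter n double (code s).*2.+1.
Proof. by rewrite -cons_codeE /cons_code CodeSeq.codeK. Qed.

Lemma iter_half_double i n m : i <= n ->
  iter i half (iter n double m) = iter (n - i) double m.
Proof.
elim: i n m => [|i IHi] [|n] m // le_in.
by rewrite iterSr iterS doubleK IHi.
Qed.

Lemma rec_cons n f g : recursive n f -> recursive n g ->
  recursive n (fun x => cons_code (f x) (g x)).
Proof.
have rd k h : recursive k h -> recursive k (fun x => (h x).*2).
  move=> rh; apply: recursive_ext (rec_add rh rh) _ => x.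
  by rewrite addnn.
have rdouble : rec1 double by apply: rd; apply: rec_var.
move=> rf rg; apply: recursive_ext (rec_iter rdouble rf (rec_succ (rd _ _ rg))) _.
by move=> x; rewrite cons_codeE.
Qed.

Lemma rec_half_fun : rec1 half.
Proof. by apply: rec_half; apply: rec_var. Qed.

Lemma rec_head n f : recursive n f -> recursive n (fun x => head_code (f x)).
Proof.
apply: (rec_app1 (F := head_code)).
(* The head is the least number of halvings that leads to an odd number. The code 0 of the empty
   list never becomes odd, so it is caught first. *)
pose f1 x := if nth 0 x 1 == 0 then 0 else
  ~~ odd (iter (nth 0 x 0) half (nth 0 x 1)) : nat.
apply: (rec_mu (f := f1)).
  apply: rec_if; [|exact: rec_const|].
    by apply: rec_eq; [apply: rec_var | apply: rec_const].
  apply: rec_negb; apply: rec_odd.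
  by apply: rec_iter rec_half_fun _ _; apply: rec_var.
move=> x; rewrite /f1 /= /head_code -[nth 0 x 0]CodeSeq.decodeK.
move: (decode (nth 0 x 0)) => s; rewrite CodeSeq.codeK.
case: s => [|k s]; first by split.
rewrite code_cons [head _ _]/=; split=> [|i lt_in].
  by rewrite iter_half_double // subnn /= odd_double; case: eqP.
rewrite (iter_half_double _ (ltnW lt_in)) -(subnSK lt_in) /= odd_double.
by case: eqP => // e0; have := CodeSeq.codeK (k :: s); rewrite code_cons e0.
Qed.

(** For a nonempty list, as many halvings as the head says leave twice the code of the tail plus
    one; one more halving gives the tail. *)
Lemma rec_behead n f : recursive n f -> recursive n (fun x => behead_code (f x)).
Proof.
move=> rf; apply: recursive_ext
  (rec_half (rec_iter rec_half_fun (rec_head rf) rf)) _ => x.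
rewrite /head_code /behead_code -[f x]CodeSeq.decodeK.
move: (decode (f x)) => s; rewrite CodeSeq.codeK.
case: s => [|k s]; first by [].
by rewrite code_cons iter_half_double // subnn /= uphalf_double.
Qed.

Lemma iter_behead_code i m : iter i behead_code m = code (drop i (decode m)).
Proof.
elim: i => [|i /= ->]; first by rewrite drop0 CodeSeq.decodeK.
by rewrite /behead_code CodeSeq.codeK -drop1 drop_drop add1n.
Qed.

Lemma rec_nth n f g : recursive n f -> recursive n g ->
  recursive n (fun x => nth_code (f x) (g x)).
Proof.
have rb : rec1 behead_code by apply: rec_behead; apply: rec_var.
move=> rf rg; apply: recursive_ext (rec_head (rec_iter rb rg rf)) _ => x.
by rewrite iter_behead_code /head_code CodeSeq.codeK -nth0 nth_drop addn0.
Qed.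

Lemma rec_size n f : recursive n f -> recursive n (fun x => size_code (f x)).
Proof.
have rb : rec1 behead_code by apply: rec_behead; apply: rec_var.
apply: (rec_app1 (F := size_code)).
apply: (rec_mu (f := fun x => iter (nth 0 x 0) behead_code (nth 0 x 1))).
  by apply: rec_iter => //; apply: rec_var.
move=> x /=; rewrite iter_behead_code /size_code drop_size; split=> // i.
rewrite iter_behead_code => lti /(code_inj (x2 := [::])) /(congr1 size).
by rewrite size_drop => /eqP; rewrite subn_eq0 leqNgt lti.
Qed.

(* The parameter [p] stands for the free variables of the step function. *)
Lemma rec_foldl F n p a s :
  rec3 F -> recursive n p -> recursive n a -> recursive n s ->
  recursive n (fun x => foldl (F (p x)) (a x) (decode (s x))).
Proof.
move=> rF; apply: (rec_app3 (F := fun p a s => foldl (F p) a (decode s))).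
(* The fold over the first [i] entries, with [i] as first variable, is a primitive recursion on [i];
   the full fold is the case where [i] is the size. *)
pose h x := foldl (F (nth 0 x 1)) (nth 0 x 2)
  [seq nth_code (nth 0 x 3) i | i <- iota 0 (nth 0 x 0)].
have rh : recursive 4 h.
  apply: (rec_nat (f := fun x => nth 0 x 1) (g := fun x =>
    F (nth 0 x 2) (nth 0 x 1) (nth_code (nth 0 x 4) (nth 0 x 0)))) => //.
  - exact: rec_var.
  - apply: rec_app3 => //; try exact: rec_var.
    by apply: rec_nth; apply: rec_var.
  - by move=> i x; rewrite /h -[nth 0 _ 0]/i.+1 -[i.+1]addn1 iotaD map_cat foldl_cat.
pose gs : seq (seq nat -> nat) := [:: fun x => size_code (nth 0 x 2);
  nth 0 ^~ 0; nth 0 ^~ 1; nth 0 ^~ 2].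
apply: recursive_ext (rec_comp (gs := gs) rh _) _ => [|x].
  case=> [|[|[|[]]]] //= _; try exact: rec_var.
  by apply: rec_size; apply: rec_var.
by rewrite /h /= -[in RHS](mkseq_nth 0 (decode (nth 0 x 2))).
Qed.

(** * The certificates *)

Definition inv_code L := if odd L then L.-1 else L.+1.

Definition rev_code w := foldl (fun acc L => cons_code L acc) 0 (decode w).

Definition inv_word_code w :=
  foldl (fun acc L => cons_code (inv_code L) acc) 0 (decode w).

(** Left multiplication of the reduced word [st] by the inverse of the letter [L]. The test
    [st != 0] is needed because the head of the empty list defaults to 0, which is also a letter.
    Pushing a word [w] letter by letter multiplies by the inverse of [w], so [mem_check] compares
    inverses. *)
Definition push_code st L :=
  if (st != 0) && (head_code st == L) then behead_code st
  else cons_code (inv_code L) st.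

Definition push_word_code st w := foldl push_code st (decode w).

Definition gen_code v E :=
  if odd E then inv_word_code (nth_code v E./2) else nth_code v E./2.

Definition mem_check e u v : bool :=
  (foldl (fun acc E => acc + (size_code v <= E./2)) 0 (decode e) == 0) &&
  (foldl (fun st E => push_word_code st (gen_code v E)) 0 (decode e)
     == push_word_code 0 u).

(* Every number [t] stands for a transposition of [nat], hence every list of  *)
(* numbers for a permutation: certificates need no validity check.            *)
Definition swap_code s t :=
  if s == head_code t then behead_code t
  else if s == behead_code t then head_code t else s.

(** Entry [n] of [c] lists the transpositions for the [n]-th letter of the basis. Transpositions are
    involutions, so the reversed list serves for the inverse letter. *)
Definition perm_code c L :=
  if odd L then rev_code (nth_code c L./2) else nth_code c L./2.

Definition act_code c s L := foldl swap_code s (decode (perm_code c L)).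

Definition act_word_code c w := foldl (act_code c) 0 (decode w).

Definition nonmem_check c u v : bool :=
  (foldl (fun acc w => acc + act_word_code c w) 0 (decode v) == 0) &&
  (act_word_code c u != 0).

(* A candidate [N] codes a pair of an answer and a refutation, the latter     *)
(* being used only when the answer is "no".                                   *)
Definition candidate_check N u v : bool :=
  if head_code N == 0 then nonmem_check (behead_code N) u v
  else mem_check (head_code N).-1 u v.

Ltac rec_vars := try by [|apply: rec_var | apply: rec_const].

Lemma rec_inv n f : recursive n f -> recursive n (fun x => inv_code (f x)).
Proof.
by move=> rf; apply: rec_if; [apply: rec_odd|apply: rec_pred|apply: rec_succ].
Qed.

Lemma rec_rev n f : recursive n f -> recursive n (fun x => rev_code (f x)).
Proof.
move=> rf; apply: (rec_foldl (F := fun _ acc L => cons_code L acc)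
  (p := fun=> 0)) rf; rec_vars.
by apply: rec_cons; rec_vars.
Qed.

Lemma rec_inv_word n f :
  recursive n f -> recursive n (fun x => inv_word_code (f x)).
Proof.
move=> rf; apply: (rec_foldl (F := fun _ acc L => cons_code (inv_code L) acc)
  (p := fun=> 0)) rf; rec_vars.
by apply: rec_cons; rec_vars; apply: rec_inv; rec_vars.
Qed.

Lemma rec_push n f g : recursive n f -> recursive n g ->
  recursive n (fun x => push_code (f x) (g x)).
Proof.
move=> rf rg; apply: rec_if; last by apply: rec_cons => //; apply: rec_inv.
  apply: rec_and; last by apply: rec_eq => //; apply: rec_head.
  by apply: rec_negb; apply: rec_eq; rec_vars.
exact: rec_behead.
Qed.

Lemma rec_push_word n f g : recursive n f -> recursive n g ->
  recursive n (fun x => push_word_code (f x) (g x)).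
Proof.
move=> rf rg; apply: (rec_foldl (F := fun=> push_code) (p := fun=> 0)) rf rg;
  rec_vars.
by apply: rec_push; rec_vars.
Qed.

Lemma rec_gen n f g : recursive n f -> recursive n g ->
  recursive n (fun x => gen_code (f x) (g x)).
Proof.
move=> rf rg; have rn : recursive n (fun x => nth_code (f x) (g x)./2).
  by apply: rec_nth => //; apply: rec_half.
by apply: rec_if => //; [apply: rec_odd | apply: rec_inv_word].
Qed.

Lemma rec_mem_check n f g h :
  recursive n f -> recursive n g -> recursive n h ->
  recursive n (fun x => mem_check (f x) (g x) (h x)).
Proof.
move=> rf rg rh; apply: rec_and; apply: rec_eq; rec_vars.
- apply: (rec_foldl (F := fun v acc E => acc + (size_code v <= E./2)));
    rec_vars.
  apply: rec_add; rec_vars.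
  by apply: rec_leq; [apply: rec_size | apply: rec_half]; rec_vars.
- apply: (rec_foldl (F := fun v st E => push_word_code st (gen_code v E)));
    rec_vars.
  by apply: rec_push_word; rec_vars; apply: rec_gen; rec_vars.
- by apply: rec_push_word; rec_vars.
Qed.

Lemma rec_swap n f g : recursive n f -> recursive n g ->
  recursive n (fun x => swap_code (f x) (g x)).
Proof.
move=> rf rg; have rh := rec_head rg; have rb := rec_behead rg.
by do 2?[apply: rec_if => //; first exact: rec_eq].
Qed.

Lemma rec_perm n f g : recursive n f -> recursive n g ->
  recursive n (fun x => perm_code (f x) (g x)).
Proof.
move=> rf rg; have rn : recursive n (fun x => nth_code (f x) (g x)./2).
  by apply: rec_nth => //; apply: rec_half.
by apply: rec_if => //; [apply: rec_odd | apply: rec_rev].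
Qed.

Lemma rec_act n f g h : recursive n f -> recursive n g -> recursive n h ->
  recursive n (fun x => act_code (f x) (g x) (h x)).
Proof.
move=> rf rg rh.
apply: (rec_foldl (F := fun=> swap_code) (p := fun=> 0)) rg _; rec_vars.
  by apply: rec_swap; rec_vars.
exact: rec_perm.
Qed.

Lemma rec_act_word n f g : recursive n f -> recursive n g ->
  recursive n (fun x => act_word_code (f x) (g x)).
Proof.
move=> rf rg; apply: (rec_foldl (F := act_code)); rec_vars.
by apply: rec_act; rec_vars.
Qed.

Lemma rec_nonmem_check n f g h :
  recursive n f -> recursive n g -> recursive n h ->
  recursive n (fun x => nonmem_check (f x) (g x) (h x)).
Proof.
move=> rf rg rh; apply: rec_and.
  apply: rec_eq; rec_vars.
  apply: (rec_foldl (F := fun c acc w => acc + act_word_code c w)); rec_vars.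
  by apply: rec_add; rec_vars; apply: rec_act_word; rec_vars.
by apply: rec_negb; apply: rec_eq; rec_vars; apply: rec_act_word.
Qed.

Lemma rec_candidate_check n f g h :
  recursive n f -> recursive n g -> recursive n h ->
  recursive n (fun x => candidate_check (f x) (g x) (h x)).
Proof.
move=> rf rg rh; have rhf := rec_head rf.
(* The coercion from booleans to numbers is moved into the branches to fit [rec_if]. *)
apply: (recursive_ext (f := fun x => if head_code (f x) == 0
  then nonmem_check (behead_code (f x)) (g x) (h x) : nat
  else mem_check (head_code (f x)).-1 (g x) (h x) : nat)).
  apply: rec_if; first by apply: rec_eq; rec_vars.
    by apply: rec_nonmem_check => //; apply: rec_behead.
  by apply: rec_mem_check => //; apply: rec_pred.
by move=> x; rewrite /candidate_check; case: ifP.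
Qed.

(** Minimization returns the least candidate that passes, and its head is the output. One [p] serves
    all inputs, and all alphabets as well. *)
Lemma candidate_search :
  exists p : recfun 2, forall N u v, candidate_check N u v ->
    exists2 N', candidate_check N' u v &
      computes p [tuple u; v] (head_code N').
Proof.
have [p pP] : recursive 3 (fun x =>
    ~~ candidate_check (nth 0 x 0) (nth 0 x 1) (nth 0 x 2)).
  by apply: rec_negb; apply: rec_candidate_check; rec_vars.
have [q qP] : rec1 head_code by apply: rec_head; rec_vars.
exists (Comp q (fun=> Mu p)) => N u v checkN.
have exN : exists N, candidate_check N u v by exists N.
case: (ex_minnP exN) => N' checkN' minN'; exists N' => //=.
exists [tuple N'] => [i|]; last exact: (qP [tuple N']).
rewrite ord1; split=> [|j ltjN].
  by have := pP [tuple N'; u; v]; rewrite /= checkN'.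
exists 0; have := pP [tuple j; u; v]; rewrite /=.
by case: (boolP (candidate_check j u v)) => // /minN'; rewrite leqNgt ltjN.
Qed.

(** * Words and their codes *)

Lemma foldl_map (S T R : Type) (f : R -> T -> R) (g : S -> T) z s :
  foldl f z [seq g x | x <- s] = foldl (fun z x => f z (g x)) z s.
Proof. by elim: s z => /=. Qed.

Lemma foldl_addn_eq0 (T : Type) (f : T -> nat) s :
  (foldl (fun acc x => acc + f x) 0 s == 0) = all (fun x => f x == 0) s.
Proof.
(* The trivial conjunct makes room for an arbitrary initial accumulator in the induction. *)
transitivity ((0 == 0) && all (fun x => f x == 0) s) => //.
elim: s {1 3}0 => [|x s IHs] m; first by rewrite andbT.
by rewrite /= IHs addn_eq0 andbA.
Qed.

Lemma rev_codeE s : rev_code (code s) = code (rev s).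
Proof.
rewrite /rev_code CodeSeq.codeK /rev -[X in foldl _ X]/(code [::]).
elim: s [::] => //= L s IHs t.
by rewrite [cons_code _ _]/cons_code CodeSeq.codeK IHs.
Qed.

Lemma inv_word_codeE s :
  inv_word_code (code s) = code (rev [seq inv_code L | L <- s]).
Proof.
rewrite /inv_word_code CodeSeq.codeK /rev -[X in foldl _ X]/(code [::]).
elim: s [::] => //= L s IHs t.
by rewrite [cons_code _ _]/cons_code CodeSeq.codeK IHs.
Qed.

Lemma odd_inv_code L : odd (inv_code L) = ~~ odd L.
Proof. by rewrite /inv_code; case: ifP => //=; case: L => //= L; case: (odd L). Qed.

Lemma half_inv_code L : (inv_code L)./2 = L./2.
Proof.
rewrite /inv_code; have := odd_double_half L.
by case: (odd L) => <-; rewrite /= ?add0n ?doubleK ?uphalf_double ?doubleK.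
Qed.

Section LetterCode.

Variables (T : Type) (num : T -> nat).
Implicit Type l : T * bool.

Definition letter_code l := (num l.1).*2 + l.2.

Lemma odd_letter_code l : odd (letter_code l) = l.2.
Proof. by rewrite oddD odd_double oddb. Qed.

Lemma half_letter_code l : (letter_code l)./2 = num l.1.
Proof. by rewrite /letter_code addnC half_bit_double. Qed.

Lemma inv_letter_code l : inv_code (letter_code l) = letter_code (l.1, ~~ l.2).
Proof.
rewrite /inv_code odd_letter_code /letter_code /=.
by case: l.2; rewrite ?addn1 ?addn0.
Qed.

Lemma letter_code_inj : injective num -> injective letter_code.
Proof.
move=> num_inj [a b] [a' b'] eq_ab.
by congr (_, _); [apply: num_inj; have := congr1 half eq_ab |
  have := congr1 odd eq_ab]; rewrite ?half_letter_code ?odd_letter_code.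
Qed.

End LetterCode.

Section FreeGroupCodes.

Variable A : finType.
Implicit Types (l : A * bool) (w : word A) (x : freeGroup A).

Definition letter_elt l : freeGroup A := word_elt [:: l].

Lemma word_elt_cons l w : word_elt (l :: w) = (letter_elt l * word_elt w)%g.
Proof. by rewrite /letter_elt /word_elt /word_prod big_cons big_seq1. Qed.

Lemma letter_elt_linv l : letter_elt (linv l) = (letter_elt l)^-1%g.
Proof.
rewrite /letter_elt /word_elt /word_prod !big_seq1 /=.
by case: l.2; rewrite ?invgK.
Qed.

Lemma val_word_elt w : val (word_elt w) = reduce w.
Proof.
elim: w => [|[a b] w IHw]; first by rewrite /word_elt /word_prod big_nil.
have val_letter : val (letter_elt (a, b)) = [:: (a, b)].
  by rewrite /letter_elt /word_elt /word_prod big_seq1; case: b.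
by rewrite word_elt_cons [val _]val_free_mul val_letter /= IHw.
Qed.

Lemma val_letter_mul l x : val (letter_elt l * x)%g = lcons l (val x).
Proof. by rewrite [val _]val_free_mul val_word_elt. Qed.

Lemma word_elt_inv w : word_elt (rev (map (@linv A) w)) = (word_elt w)^-1%g.
Proof.
elim: w => [|l w IHw]; first by rewrite /word_elt /word_prod big_nil invg1.
rewrite /= rev_cons -cats1 word_elt_cons invgM -letter_elt_linv -IHw.
by rewrite /word_elt /word_prod big_cat.
Qed.

Local Notation rank := (fun a : A => enum_rank a : nat).

Lemma code_wordE w : code_word w = code (map (letter_code rank) w).
Proof. by []. Qed.

Lemma letter_code_rank_inj : injective (letter_code rank).
Proof. by apply: letter_code_inj => a b /val_inj/enum_rank_inj. Qed.

Lemma code_word_inj : injective (@code_word A).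
Proof. by move=> w1 w2 /code_inj; apply: inj_map; exact: letter_code_rank_inj. Qed.

Lemma push_code_letter l x :
  push_code (code_word (val x)) (letter_code rank l) =
  code_word (val ((letter_elt l)^-1 * x)%g).
Proof.
rewrite -letter_elt_linv val_letter_mul /push_code inv_letter_code.
rewrite /head_code /behead_code /cons_code !code_wordE CodeSeq.codeK.
have -> (s : seq nat) : (code s != 0) = (s != [::]).
  by rewrite -(inj_eq code_inj).
case: (val x) => [|l1 w] //=.
by rewrite (inj_eq letter_code_rank_inj) linvK; case: eqP.
Qed.

Lemma push_code_word w x :
  push_word_code (code_word (val x)) (code_word w) =
  code_word (val ((word_elt w)^-1 * x)%g).
Proof.
rewrite /push_word_code [code_word w]code_wordE CodeSeq.codeK.
elim: w x => [|l w IHw] x; first by rewrite /word_elt /word_prod big_nil invg1 mul1g.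
by rewrite [LHS]/= push_code_letter IHw word_elt_cons invgM mulgA.
Qed.

Lemma inv_code_word w :
  inv_word_code (code_word w) = code_word (rev (map (@linv A) w)).
Proof.
rewrite !code_wordE inv_word_codeE map_rev -!map_comp; congr (code (rev _)).
by apply: eq_map => l; rewrite /= inv_letter_code.
Qed.

Section Membership.

Variables (u : word A) (k : nat) (v : k.-tuple (word A)).
Local Notation g := (fun i => word_elt (tnth v i)).

Lemma size_code_words : size_code (code_words v) = k.
Proof. by rewrite /size_code CodeSeq.codeK size_map size_tuple. Qed.

Lemma nth_code_words (i : 'I_k) :
  nth_code (code_words v) i = code_word (tnth v i).
Proof.
rewrite /nth_code CodeSeq.codeK (nth_map [::]) ?size_tuple //.
by rewrite (tnth_nth [::]).
Qed.

Lemma push_gen_code (l : 'I_k * bool) x :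
  push_word_code (code_word (val x))
    (gen_code (code_words v) (letter_code (@nat_of_ord k) l)) =
  code_word (val ((if l.2 then (g l.1)^-1 else g l.1)^-1 * x)%g).
Proof.
rewrite /gen_code odd_letter_code half_letter_code nth_code_words.
by case: l.2; rewrite ?inv_code_word push_code_word ?word_elt_inv.
Qed.

Lemma push_gens_code (e : word 'I_k) x :
  foldl (fun st E => push_word_code st (gen_code (code_words v) E))
    (code_word (val x)) (map (letter_code (@nat_of_ord k)) e) =
  code_word (val ((word_prod g e)^-1 * x)%g).
Proof.
elim: e x => [|l e IHe] x; first by rewrite /word_prod big_nil invg1 mul1g.
by rewrite [LHS]/= push_gen_code IHe /word_prod big_cons invgM mulgA.
Qed.

Lemma decode_expression s : all (fun E => E./2 < k) s ->
  exists e : word 'I_k, s = map (letter_code (@nat_of_ord k)) e.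
Proof.
elim: s => [|E s IHs] /=; first by exists [::].
case/andP=> ltEk /IHs[e ->]; exists ((Ordinal ltEk, odd E) :: e) => /=.
by rewrite /letter_code /= addnC odd_double_half.
Qed.

Lemma mem_checkP n :
  reflect (exists2 e : word 'I_k, n = code_word_by (@nat_of_ord k) e &
             word_elt u = word_prod g e)
          (mem_check n (code_word u) (code_words v)).
Proof.
have mem_eq (e : word 'I_k) :
    (foldl (fun st E => push_word_code st (gen_code (code_words v) E)) 0
      (map (letter_code (@nat_of_ord k)) e)
      == push_word_code 0 (code_word u)) = (word_elt u == word_prod g e).
  have -> : 0 = code_word (val (1%g : freeGroup A)) by [].
  rewrite push_gens_code push_code_word !mulg1 (inj_eq code_word_inj).
  by rewrite (inj_eq val_inj) (inj_eq invg_inj) eq_sym.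
rewrite /mem_check foldl_addn_eq0 size_code_words.
rewrite (eq_all (a2 := fun E => E./2 < k)) => [|E]; last first.
  by rewrite eqb0 -ltnNge.
apply: (iffP andP) => [[/decode_expression[e de]]|[e -> ue]].
  rewrite de mem_eq => /eqP ue; exists e => //.
  by rewrite -[n]CodeSeq.decodeK de.
rewrite /code_word_by CodeSeq.codeK mem_eq ue eqxx; split=> //.
apply/allP => _ /mapP[l _ ->].
by rewrite half_letter_code.
Qed.

End Membership.

(** * Permutation actions *)

Section Action.

Variables (S : Type) (act : S -> A * bool -> S).
Hypothesis actK : forall s l, act (act s l) (linv l) = s.

(** Cancelled pairs act trivially by [actK], so the right action of words descends to the free
    group. *)
Lemma foldl_act_reduce s w : foldl act s (reduce w) = foldl act s w.
Proof.
have act_lcons l w' s' : foldl act s' (lcons l w') = foldl act s' (l :: w').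
  by case: w' => //= l1 w'; case: eqP => // ->; rewrite /= actK.
elim: w s => //= l w IHw s.
by rewrite act_lcons /= IHw.
Qed.

Lemma foldl_act_val s w : foldl act s (val (word_elt w)) = foldl act s w.
Proof. by rewrite val_word_elt foldl_act_reduce. Qed.

Lemma stabilizer_subgroup s : is_subgroup (fun x => foldl act s (val x) = s).
Proof.
have actM x y : foldl act s (val (x * y)%g) = foldl act (foldl act s (val x)) (val y).
  by rewrite -foldl_cat foldl_act_reduce.
split=> // [x y fx fy|x fx]; first by rewrite actM fx.
by rewrite -{1}fx -actM mulgV.
Qed.

End Action.

End FreeGroupCodes.

(** * Permutations of the natural numbers as lists of transpositions *)

Lemma swap_code_cons s p q :
  swap_code s (cons_code p q) = if s == p then q else if s == q then p else s.
Proof.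
by rewrite /swap_code /head_code /behead_code /cons_code !CodeSeq.codeK
  CodeSeq.decodeK.
Qed.

Lemma swap_codeK t : involutive (swap_code ^~ t).
Proof.
rewrite /swap_code => s; case: (eqVneq s (head_code t)) => [->|nh].
  by rewrite eqxx; case: eqP.
case: (eqVneq s (behead_code t)) => [->|nb]; first by rewrite eqxx.
by rewrite (negPf nh) (negPf nb).
Qed.

Lemma foldl_swap_rev s ts : foldl swap_code (foldl swap_code s ts) (rev ts) = s.
Proof.
elim: ts s => //= t ts IHts s.
by rewrite rev_cons foldl_rcons IHts swap_codeK.
Qed.

Lemma act_codeK c s L : act_code c (act_code c s L) (inv_code L) = s.
Proof.
rewrite /act_code /perm_code odd_inv_code half_inv_code.
rewrite -[nth_code _ _]CodeSeq.decodeK rev_codeE.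
case: (odd L); rewrite !CodeSeq.codeK ?foldl_swap_rev //.
by rewrite -{2}[decode _]revK foldl_swap_rev.
Qed.

(** The stabilizer of 0 is a subgroup; it contains the [v_i], hence everything they generate, but
    not [u]. *)
Lemma nonmem_check_sound (A : finType) c (u : word A) k (v : k.-tuple (word A)) :
  nonmem_check c (code_word u) (code_words v) ->
  ~ subgroup_gen (fun i => word_elt (tnth v i)) (word_elt u).
Proof.
pose rank (a : A) : nat := enum_rank a.
pose act s l := act_code c s (letter_code rank l).
have actK s l : act (act s l) (linv l) = s.
  by rewrite /act /linv -inv_letter_code act_codeK.
have act_wordE w : act_word_code c (code_word w) = foldl act 0 w.
  by rewrite /act_word_code code_wordE CodeSeq.codeK foldl_map.
rewrite /nonmem_check foldl_addn_eq0 act_wordE CodeSeq.codeK all_map.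
case/andP=> /all_tnthP fix_v /eqP move_u Hu; case: move_u.
rewrite -(foldl_act_val actK); apply: Hu (stabilizer_subgroup actK 0) _ => i.
by rewrite foldl_act_val // -act_wordE; apply/eqP/fix_v.
Qed.

(* Add the pairs one at a time: if the permutation built so far sends [p] to  *)
(* [r] instead of [q], follow it by the transposition of [r] and [q].         *)
Lemma partial_injection_swaps (d : seq (nat * nat)) :
  {in d &, forall x y, (x.1 == y.1) = (x.2 == y.2)} ->
  exists ts, {in d, forall x, foldl swap_code x.1 ts = x.2}.
Proof.
elim: d => [|[p q] d IHd] injd; first by exists [::].
have [|ts tsP] := IHd.
  by move=> x y dx dy; apply: injd; rewrite inE ?dx ?dy orbT.
pose r := foldl swap_code p ts.
exists (rcons ts (cons_code r q)) => x; rewrite inE foldl_rcons.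
case/orP => [/eqP-> | dx]; first by rewrite swap_code_cons eqxx.
have := injd x (p, q); rewrite !inE dx eqxx orbT /= => /(_ isT isT).
rewrite (tsP _ dx) swap_code_cons.
case: (eqVneq x.1 p) => [xp /esym/eqP xq | xp /esym/negbT xq].
  by rewrite -xq /r -xp (tsP _ dx) !if_same.
rewrite (negPf xq); case: eqP => // xr.
(* Otherwise [x.1] and [p] have the same image under [ts], and undoing [ts] gives [x.1 = p]. *)
have := congr1 (foldl swap_code ^~ (rev ts)) xr.
by rewrite -(tsP _ dx) !foldl_swap_rev => /eqP; rewrite (negPf xp).
Qed.

(** * The action on right cosets and its extension to permutations *)

Section CosetAction.

Variables (A : finType) (H : freeGroup A -> Prop).
Hypothesis H_subgroup : is_subgroup H.
Implicit Types (x y : freeGroup A) (l : A * bool) (w : word A).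
Local Notation rank := (fun a : A => enum_rank a : nat).

(** Equality of the right cosets [H x] and [H y], made boolean by excluded middle so that [find] can
    number cosets. *)
Definition coset_rel x y : bool :=
  if excluded_middle_informative (H (x * y^-1)%g) then true else false.

Lemma coset_relP x y : reflect (H (x * y^-1)%g) (coset_rel x y).
Proof. by rewrite /coset_rel; case: excluded_middle_informative; constructor. Qed.

Lemma coset_rel_refl x : coset_rel x x.
Proof. by apply/coset_relP; rewrite mulgV; case: H_subgroup. Qed.

Lemma coset_rel_sym x y : coset_rel x y -> coset_rel y x.
Proof.
case: H_subgroup => _ _ HV /coset_relP/HV Hyx; apply/coset_relP.
by rewrite invgM invgK in Hyx.
Qed.

Lemma coset_rel_trans x y z : coset_rel x y -> coset_rel y z -> coset_rel x z.
Proof.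
case: H_subgroup => _ HM _ /coset_relP Hxy /coset_relP Hyz; apply/coset_relP.
by have := HM _ _ Hxy Hyz; rewrite mulgA mulgVK.
Qed.

Lemma coset_rel_mulr z x y : coset_rel (x * z)%g (y * z)%g = coset_rel x y.
Proof. by rewrite /coset_rel invgM mulgA mulgK. Qed.

Variable ws : seq (freeGroup A).

(** The first listed representative of a coset gives its number. With 1 in front, [H] itself gets 0,
    the base point of [act_word_code]. *)
Definition coset_num x := find (coset_rel x) (1%g :: ws).

Lemma coset_num1 : coset_num 1%g = 0.
Proof. by rewrite /coset_num /= coset_rel_refl. Qed.

Lemma eq_coset_num :
  {in 1%g :: ws &, forall x y, (coset_num x == coset_num y) = coset_rel x y}.
Proof.
move=> x y ws_x ws_y; apply/eqP/idP => [eq_xy | rxy]; last first.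
  apply: eq_find => z; apply/idP/idP; apply: coset_rel_trans => //.
  exact: coset_rel_sym.
have nthP z : z \in 1%g :: ws -> coset_rel z (nth 1%g (1%g :: ws) (coset_num z)).
  move=> ws_z; apply: nth_find; apply/hasP; exists z => //.
  exact: coset_rel_refl.
apply: coset_rel_trans (nthP _ ws_x) _; rewrite eq_xy.
exact/coset_rel_sym/nthP.
Qed.

(* M. Hall: the right multiplications by letters are partial injections of    *)
(* the finite set of cosets of [1 :: ws]; extend them to permutations.        *)
Lemma coset_action : exists c, forall x l,
  x \in 1%g :: ws -> (x * letter_elt l)%g \in 1%g :: ws ->
  act_code c (coset_num x) (letter_code rank l) =
  coset_num (x * letter_elt l)%g.
Proof.
pose mulr a x := (x * letter_elt (a, false))%g.
have [a | ts tsP] := @fin_all_exists A (fun=> seq nat)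
    (fun a ts => {in 1%g :: ws, forall x, mulr a x \in 1%g :: ws ->
       foldl swap_code (coset_num x) ts = coset_num (mulr a x)}).
  pose d := [seq (coset_num x, coset_num (mulr a x)) |
              x <- [seq x <- 1%g :: ws | mulr a x \in 1%g :: ws]].
  have [_ _ /mapP[x + ->] /mapP[y + ->] | ts tsP] := @partial_injection_swaps d.
    (* The table [d] is a partial injection, since right multiplication preserves and reflects
       equality of cosets. *)
    rewrite !mem_filter => /andP[ws_xa ws_x] /andP[ws_ya ws_y] /=.
    by rewrite !eq_coset_num // coset_rel_mulr.
  exists ts => x ws_x ws_xa; have := tsP (coset_num x, coset_num (mulr a x)).
  by apply; apply/mapP; exists x; rewrite // mem_filter ws_xa.
exists (code [seq code (ts a) | a <- enum A]) => x [a b] ws_x.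
have nthE : nth_code (code [seq code (ts a) | a <- enum A]) (rank a) = code (ts a).
  rewrite /nth_code CodeSeq.codeK (nth_map a) ?nth_enum_rank //.
  by rewrite -cardE.
rewrite /act_code /perm_code odd_letter_code half_letter_code nthE /=.
case: b => [|ws_xa]; last by rewrite CodeSeq.codeK; apply: tsP.
rewrite rev_codeE CodeSeq.codeK -[(a, true)]/(linv (a, false)) letter_elt_linv.
(* For an inverse letter, the list [ts a] sends the coset of [y] to that of [x], and its reversal
   leads back. *)
set y := (x * _)%g => ws_y; have xE : x = mulr a y by rewrite /mulr mulgVK.
by rewrite [in LHS]xE -tsP -?xE // foldl_swap_rev.
Qed.

Lemma coset_action_word c x w :
  (forall x l, x \in 1%g :: ws -> (x * letter_elt l)%g \in 1%g :: ws ->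
    act_code c (coset_num x) (letter_code rank l) =
    coset_num (x * letter_elt l)%g) ->
  (forall i, (x * word_elt (take i w))%g \in 1%g :: ws) ->
  foldl (act_code c) (coset_num x) (map (letter_code rank) w) =
  coset_num (x * word_elt w)%g.
Proof.
move=> actP; elim: w x => [|l w IHw] x ws_w.
  by rewrite /word_elt /word_prod big_nil mulg1.
have ws_x : x \in 1%g :: ws.
  by have := ws_w 0; rewrite take0 /word_elt /word_prod big_nil mulg1.
have ws_xl : (x * letter_elt l)%g \in 1%g :: ws.
  by have := ws_w 1; rewrite /= take0.
rewrite [LHS]/= actP // IHw ?word_elt_cons ?mulgA // => i.
by have := ws_w i.+1; rewrite [take _ _]/= word_elt_cons mulgA.
Qed.

End CosetAction.

(** * Existence of certificates and the decision procedure *)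

Lemma subgroup_gen_subgroup (T : Type) (G : groupType) (g : T -> G) :
  is_subgroup (subgroup_gen g).
Proof.
split=> [|x y gx gy|x gx] H HH Hg; case: (HH) => H1 HM HV //.
  by apply: HM; [apply: gx | apply: gy].
by apply: HV; apply: gx.
Qed.

Lemma nonmem_check_complete (A : finType) (u : word A) k
    (v : k.-tuple (word A)) :
  ~ subgroup_gen (fun i => word_elt (tnth v i)) (word_elt u) ->
  exists c, nonmem_check c (code_word u) (code_words v).
Proof.
set H := subgroup_gen _ => notHu.
have H_subgroup : is_subgroup H by apply: subgroup_gen_subgroup.
(* With all prefixes listed, tracing [u] or a [v_i] from the coset of 1 never leaves the list, as
   [coset_action_word] requires. *)
pose ws := [seq word_elt (take i w) | w <- u :: v, i <- iota 0 (size w).+1].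
have [c cP] := coset_action H_subgroup ws; exists c.
have ws_take w i : w \in u :: v -> word_elt (take i w) \in 1%g :: ws.
  move=> vw; rewrite inE; apply/orP; right; apply/allpairsPdep.
  exists w, (minn i (size w)); rewrite take_min take_size; split=> //.
  by rewrite mem_iota add0n ltnS geq_minr.
have ws_word w : w \in u :: v -> word_elt w \in 1%g :: ws.
  by move=> vw; rewrite -[w]take_size ws_take.
(* Such a word ends at the coset of its own element, so it fixes 0 iff that element lies in [H]. *)
have actE w : w \in u :: v ->
    (act_word_code c (code_word w) == 0) = coset_rel H (word_elt w) 1%g.
  move=> vw; rewrite /act_word_code code_wordE CodeSeq.codeK.
  rewrite -[X in foldl _ X](coset_num1 H_subgroup ws).
  rewrite (coset_action_word cP) => [|i]; last by rewrite mul1g ws_take.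
  rewrite mul1g -(coset_num1 H_subgroup ws) eq_coset_num ?mem_head //.
  exact: ws_word.
rewrite /nonmem_check foldl_addn_eq0 CodeSeq.codeK all_map actE ?mem_head //.
apply/andP; split; last by apply/coset_relP; rewrite invg1 mulg1.
apply/all_tnthP => i; rewrite /= actE ?inE ?mem_tnth ?orbT //.
by apply/coset_relP; rewrite invg1 mulg1 => K _; apply.
Qed.

Lemma subgroup_gen_prod (T : Type) (G : groupType) (g : T -> G) x :
  subgroup_gen g x <-> exists e : word T, x = word_prod g e.
Proof.
split=> [gx | [e ->{x}] H [H1 HM HV] Hg]; last first.
  rewrite /word_prod; elim/big_ind: _ => // -[a b] _ /=.
  by case: b => //; apply: HV.
apply: (gx (fun x => exists e : word T, x = word_prod g e)) => [|a]; last first.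
  by exists [:: (a, false)]; rewrite /word_prod big_seq1.
split=> [|_ _ [e ->] [e' ->]|_ [e ->]].
- by exists [::]; rewrite /word_prod big_nil.
- by exists (e ++ e'); rewrite /word_prod big_cat.
exists (rev [seq (l.1, ~~ l.2) | l <- e]).
elim: e => [|l e IHe]; first by rewrite /word_prod !big_nil invg1.
rewrite [map _ _]/= rev_cons -cats1 /word_prod big_cat big_seq1 big_cons invgM.
by congr (_ * _)%g; case: l.2; rewrite ?invgK.
Qed.

Theorem mainTheorem2 (A : finType) :
  exists p : recfun 2,
    forall (u : word A) (k : nat) (v : k.-tuple (word A)),
      exists2 o : option (word 'I_k),
        computes p [tuple code_word u; code_words v] (code_answer o) &
        correct_answer u v o.
Proof.
have [p pP] := candidate_search; exists p => u k v.
set g := fun i => word_elt (tnth v i).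
have [N checkN] : exists N, candidate_check N (code_word u) (code_words v).
  (* The case distinction only proves that the search halts. *)
  have [Hu | notHu] := classic (subgroup_gen g (word_elt u)).
    have [e ue] := (subgroup_gen_prod g (word_elt u)).1 Hu.
    exists (cons_code (code_word_by (@nat_of_ord k) e).+1 0).
    rewrite /candidate_check /head_code /cons_code CodeSeq.codeK /=.
    by apply/mem_checkP; exists e.
  have [c checkc] := nonmem_check_complete notHu; exists (cons_code 0 c).
  rewrite /candidate_check /head_code /behead_code /cons_code CodeSeq.codeK /=.
  by rewrite CodeSeq.decodeK.
have [N' checkN' computesN'] := pP _ _ _ checkN.
(* The head of the candidate found is already the coded answer: 0 for no, the successor of the coded
   expression for yes. *)
move: checkN'; rewrite /candidate_check; case: eqP => [N'0 | /eqP N'0].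
  by rewrite N'0 in computesN' => /nonmem_check_sound; exists None.
case/mem_checkP => e eE ue; exists (Some e) => /=.
  by rewrite -eE prednK // lt0n.
by split=> //; apply/subgroup_gen_prod; exists e.
Qed.
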